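(* Let $e\ge 2$ be an integer, let $d\in(\mathbb{Z}/e\mathbb{Z})^{\times}$, and let $K$ be a field with $\operatorname{char}K=0$ and $\operatorname{Gal}(K(\zeta_e)/K)\simeq(\mathbb{Z}/e\mathbb{Z})^{\times}$. Let $\sigma_{-d}$ be the $K$-automorphism of $K(\zeta_e)$ with $\zeta_e\mapsto\zeta_e^{-d}$. For $u=1,2$ let ${\bf p}_u\in K^{\times}$, let $v_u$ be an integer with $ev_u/2\in\mathbb{Z}$, and let $E_{{\bf p}_u}$ be generalized Jacobi sums for ${\bf p}_u$ with respect to $v_u$. Then: (A1) The map $(E_{{\bf p}_1}\overset{d}{\ast}E_{{\bf p}_2})(a,b):=-\sigma_{-d}(E_{{\bf p}_1}(a,b))\,E_{{\bf p}_2}(a,b)$ is a family of generalized Jacobi sums for ${\bf p}_1{\bf p}_2$ with respect to $v_1+v_2$. (A2) Put $f_u=({\bf p}_u-1)/e$ and define the $e\times e$ matrix $H_{{\bf p}_u}$ by $$H_{{\bf p}_u}[i,j]=-f_u\delta_{i,\frac{ev_u}{2}}+\frac{1}{e^2}\sum_{a=0}^{e-1}\sum_{b=0}^{e-1}(-1)^{v_ua}\zeta_e^{-(ai+bj)}E_{{\bf p}_u}(a,b),$$ and $\mathrm{Cyc}_{{\bf p}_u}:=H_{{\bf p}_u}+[f_u\delta_{i,\frac{ev_u}{2}}]_{0\le i,j\le e-1}$. Then for all $a,b\in\mathbb{Z}$, $$(-1)^{(v_1+v_2)a+1}\sum_{i=0}^{e-1}\sum_{j=0}^{e-1}(\mathrm{Cyc}_{{\bf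 p}_1}\overset{d}{\ast}\mathrm{Cyc}_{{\bf p}_2})[i,j]\,\zeta_e^{ai+bj}=(E_{{\bf p}_1}\overset{d}{\ast}E_{{\bf p}_2})(a,b).$$ (B) In particular, take $K=\mathbb{Q}$ and prime powers $p^r,q^s$ with $p^r\equiv q^s\equiv 1\pmod e$, and let $J^*_{p^r}(a,b)$, $J^*_{q^s}(a,b)$ be the Jacobi sums of $\mathbb{F}_{p^r}$, $\mathbb{F}_{q^s}$ (which are generalized Jacobi sums for $p^r$, $q^s$ with respect to $f_1=(p^r-1)/e$, $f_2=(q^s-1)/e$ respectively). Then (B1) $(J^*_{p^r}\overset{d}{\ast}J^*_{q^s})(a,b):=-\sigma_{-d}(J^*_{p^r}(a,b))J^*_{q^s}(a,b)$ are generalized Jacobi sums for $p^rq^s$ (with respect to $f_1+f_2$); and (B2) with $f:=(p^rq^s-1)/e=f_1f_2e+f_1+f_2$ and $\lambda=f$ if $(p,q)\ne(2,2)$, $\lambda=0$ if $(p,q)=(2,2)$, for all $a,b\in\mathbb{Z}$, $$(-1)^{\lambda a+1}\sum_{i=0}^{e-1}\sum_{j=0}^{e-1}(\mathrm{Cyc}_{p^r}\overset{d}{\ast}\mathrm{Cyc}_{q^s})[i,j]\,\zeta_e^{ai+bj}=(J^*_{p^r}\overset{d}{\ast}J^*_{q^s})(a,b),$$ where $\mathrm{Cyc}_{p^r}=[\mathrm{Cyc}_{p^r}(i,j)]_{0\le i,j\le e-1}$ and $\mathrm{Cyc}_{q^s}=[\mathrm{Cyc}_{q^s}(i,j)]_{0\le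 i,j\le e-1}$ are the matrices of cyclotomic numbers.
   Context: $\zeta_n=e^{2\pi i/n}$. For $c$ coprime to $e$, $\sigma_c$ denotes the $K$-automorphism of $K(\zeta_e)$ with $\zeta_e\mapsto\zeta_e^c$. All matrix indices and Kronecker deltas $\delta_{i,j}$ are taken modulo $e$. Generalized Jacobi sums: for ${\bf p}\in K^\times$ and an integer $v$ with $ve$ even, a map $E_{\bf p}:\mathbb{Z}\times\mathbb{Z}\to K(\zeta_e)$ is a family of generalized Jacobi sums for ${\bf p}$ (with respect to $v$) if for all $a,b,c\in\mathbb{Z}$: (1) $E_{\bf p}(a+e,b)=E_{\bf p}(a,b+e)=E_{\bf p}(a,b)$; (2) $E_{\bf p}(a,b)=E_{\bf p}(b,a)$; (3) $E_{\bf p}(a,b)=(-1)^{vb}E_{\bf p}(-a-b,b)$; (4) $E_{\bf p}(a,0)=-1$ if $e\nmid a$; (5) $E_{\bf p}(a,b)E_{\bf p}(-a,-b)={\bf p}$ if $e\nmid a$, $e\nmid b$, $e\nmid a+b$; (6) $E_{\bf p}(a,b)E_{\bf p}(-a,-c)=(-1)^{v(b+c)}E_{\bf p}(-(a+b+c),b)E_{\bf p}(a+b+c,-c)$ if $e\nmid a+b$, $e\nmid a+c$, $e\nmid a+b+c$; (7) if $\gcd(c,e)=1$ then $\sigma_c(E_{\bf p}(a,b))=E_{\bf p}(ca,cb)$. $d$-composition: for $e\times e$ matrices $A=[a_{i,j}]$, $B=[b_{i,j}]$ (indices $0,\dots,e-1$ mod $e$), $(A\overset{d}{\ast}B)[i,j]=\sum_{s=0}^{e-1}\sum_{t=0}^{e-1}a_{s,t}b_{ds+i,dt+j}$.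 Classical objects: for a prime power $p^r\equiv1\pmod e$, write $p^r=ef+1$, fix a generator $\gamma$ of $\mathbb{F}_{p^r}^\times$ and let $\chi$ be the character of order $e$ with $\chi(\gamma)=\zeta_e$, $\chi(0)=0$. The Jacobi sums are $J^*_{p^r}(a,b)=\sum_{\alpha\in\mathbb{F}_{p^r},\alpha\ne0,1}\chi^a(\alpha)\chi^b(1-\alpha)$. The cyclotomic numbers are $\mathrm{Cyc}_{p^r}(i,j)=\#\{(v_1,v_2):0\le v_1,v_2\le f-1,\ 1+\gamma^{ev_1+i}=\gamma^{ev_2+j}\text{ in }\mathbb{F}_{p^r}\}$.
   Formalization: Condition (6) is required only when also e∤a (otherwise it forces p=1 for e≥3). If p=2, J*_{p^r} is taken with respect to 0 instead of f_1 (likewise for q=2); if exactly one of p, q is 2, (B1) is with respect to 0 instead of f_1+f_2, and λ=0 instead of f in (B2). *)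

(* Defs.v *)
From HB Require Import structures.
From mathcomp Require Import all_boot all_order all_fingroup all_algebra.
From mathcomp Require Import all_solvable all_field.

Set Implicit Arguments.
Unset Strict Implicit.
Unset Printing Implicit Defensive.

Import GRing.Theory.
Local Open Scope ring_scope.

(* Throughout, L is a model of K(zeta_e) and z : L plays the role of zeta_e.
   For 1 < e the type 'I_(Zp_trunc e).+2 is 'Z_e, so the rows and columns of
   the matrices below are indexed by Z/eZ and index arithmetic is modulo e. *)

Definition is_cyclotomic_ext (e : nat) (K : fieldType)
    (L : splittingFieldType K) (z : L) : Prop :=
  e.-primitive_root z /\ <<1%VS; z>>%VS = fullv.

(* The identity is a dummy value, returned only if no automorphism maps z to
   z ^ c; when z generates L, at most one does. *)
Definition sigma (K : fieldType) (L : splittingFieldType K) (z : L) (c : int) :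
    gal_of {:L} :=
  odflt 1%g [pick s : gal_of {:L} | s z == z ^ c].

Record gen_jacobi_sums (e : nat) (K : fieldType) (L : splittingFieldType K)
    (z : L) (p : K) (v : int) (E : int -> int -> L) : Prop := GenJacobiSums {
  gjs_neq0 : p != 0;
  gjs_even : (2 %| v * e%:Z)%Z;
  gjs_periodic : forall a b : int,
    E (a + e%:Z) b = E a b /\ E a (b + e%:Z) = E a b;
  gjs_sym : forall a b : int, E a b = E b a;
  gjs_refl : forall a b : int, E a b = (-1) ^ (v * b) * E (- a - b) b;
  gjs_zero : forall a : int, ~~ (e%:Z %| a)%Z -> E a 0 = -1;
  gjs_norm : forall a b : int,
    ~~ (e%:Z %| a)%Z -> ~~ (e%:Z %| b)%Z -> ~~ (e%:Z %| a + b)%Z ->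
    E a b * E (- a) (- b) = p%:A;
  (* The case e %| a has to be excluded: for a = 0 and b, c, b + c nonzero
     modulo e, the left-hand side is 1 while the right-hand side is p, by the
     other conditions. *)
  gjs_exchange : forall a b c : int,
    ~~ (e%:Z %| a)%Z ->
    ~~ (e%:Z %| a + b)%Z -> ~~ (e%:Z %| a + c)%Z ->
    ~~ (e%:Z %| a + b + c)%Z ->
    E a b * E (- a) (- c) =
      (-1) ^ (v * (b + c)) * E (- (a + b + c)) b * E (a + b + c) (- c);
  gjs_galois : forall a b c : int,
    coprimez c e%:Z -> sigma z c (E a b) = E (c * a) (c * b)
}.

Definition dcomp_mx (e : nat) (R : nzRingType) (d : {unit 'Z_e})
    (A B : 'M[R]_((Zp_trunc e).+2)) : 'M[R]_((Zp_trunc e).+2) :=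
  \matrix_(i, j) \sum_s \sum_t A s t * B (val d * s + i) (val d * t + j).

Definition dcomp_jac (e : nat) (K : fieldType) (L : splittingFieldType K)
    (z : L) (d : {unit 'Z_e}) (E1 E2 : int -> int -> L) : int -> int -> L :=
  fun a b => - sigma z (- (val d : nat)%:Z) (E1 a b) * E2 a b.

Definition delta_term (e : nat) (K : fieldType) (L : splittingFieldType K)
    (p : K) (v : int) : 'M[L]_((Zp_trunc e).+2) :=
  \matrix_(i, j)
    (((p - 1) / e%:R)%:A *+ (i == (((e%:Z * v) %/ 2)%Z)%:~R)).

Definition H_mx (e : nat) (K : fieldType) (L : splittingFieldType K)
    (z : L) (p : K) (v : int) (E : int -> int -> L) :
    'M[L]_((Zp_trunc e).+2) :=
  \matrix_(i, j)
    (- (delta_term e L p v) i j +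
     (e%:R ^+ 2)^-1 *
     \sum_(a < e) \sum_(b < e)
        (-1) ^ (v * a%:Z) * z ^ (- (a * i + b * j)%N%:Z) * E a%:Z b%:Z).

Definition Cyc_mx (e : nat) (K : fieldType) (L : splittingFieldType K)
    (z : L) (p : K) (v : int) (E : int -> int -> L) :
    'M[L]_((Zp_trunc e).+2) :=
  H_mx e z p v E + delta_term e L p v.

Definition dft_mx (e : nat) (L : fieldType) (z : L)
    (A : 'M[L]_((Zp_trunc e).+2)) (a b : int) : L :=
  \sum_i \sum_j A i j * z ^ (a * (i : nat)%:Z + b * (j : nat)%:Z).

(* Since g generates F^*, chi is uniquely determined by these conditions; it
   has order e when z is a primitive e-th root of unity. *)
Definition is_power_char (F : finFieldType) (L : fieldType) (g : {unit F})
    (z : L) (chi : F -> L) : Prop :=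
  [/\ GRing.monoid_morphism chi, chi 0 = 0 & chi (val g) = z].

Definition jacobi_sum (F : finFieldType) (L : fieldType) (chi : F -> L)
    (a b : int) : L :=
  \sum_(x : F | (x != 0) && (x != 1)) chi x ^ a * chi (1 - x) ^ b.

Definition cyc_num (F : finFieldType) (e f : nat) (g : {unit F})
    (i j : nat) : nat :=
  #|[set v : 'I_f * 'I_f |
      1 + val g ^+ (e * v.1 + i) == val g ^+ (e * v.2 + j)]|.

Definition cyc_num_mx (F : finFieldType) (L : fieldType) (e f : nat)
    (g : {unit F}) : 'M[L]_((Zp_trunc e).+2) :=
  \matrix_(i, j) (cyc_num e f g i j)%:R.

(* Main.v *)
(** The map [(i, j) |-> d (s, t) + (i, j)] in the d-composition turns the
    two-dimensional Fourier transform of [A * B] into the product of the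
    transform of [A] at [(- d a, - d b)] with the transform of [B] at [(a, b)].
    The transform of [Cyc] at [(a, b)] is [(-1)^(v a) E(a, b)], and
    [sigma_(-d)] maps [E(a, b)] to [E(- d a, - d b)], which gives the identities
    between d-compositions; the defining relations are stable under
    [(a, b) |-> (c a, c b)] and under [(E1, E2) |-> - E1 E2].

    For the Jacobi sums of a finite field no Gauss sums are needed: the additive
    convolution of [chi^a] and [chi^b] is [J(a, b) chi^(a+b)] when e does not
    divide [a + b], so that relations (5) and (6) express the associativity and
    commutativity of a triple convolution at 1. *)

Require Import Defs.
From HB Require Import structures.
From mathcomp Require Import all_boot all_order all_fingroup all_algebra.
From mathcomp Require Import all_solvable all_field.
From mathcomp Require Import zify ring.

Set Implicit Arguments.
Unset Strict Implicit.
Unset Printing Implicit Defensive.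

Import GRing.Theory.
Local Open Scope ring_scope.

(** * Signs and roots of unity with integer exponents *)

Lemma eq_exprz_mod (R : unitRingType) (z : R) (e : nat) (m n : int) :
  (0 < e)%N -> z ^+ e = 1 -> (e%:Z %| m - n)%Z -> z ^ m = z ^ n.
Proof.
move=> e_gt0 ze1 /dvdzP[k]; have Uz : z \is a GRing.unit.
  by rewrite -(unitrX_pos z e_gt0) ze1 unitr1.
move=> /eqP; rewrite subr_eq => /eqP->.
by rewrite exprzDr // mulrC -exprz_exp -exprnP ze1 exp1rz mul1r.
Qed.

Lemma eq_signz (R : unitRingType) (m n : int) :
  (2 %| m - n)%Z -> (-1) ^ m = (-1) ^ n :> R.
Proof. by apply: (@eq_exprz_mod _ _ 2) => //; rewrite sqrrN expr1n. Qed.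

Lemma signzD (R : unitRingType) (m n : int) :
  (-1) ^ (m + n) = (-1) ^ m * (-1) ^ n :> R.
Proof. by rewrite exprzDr // unitrN1. Qed.

(** Either [e] is even, and then [c] is odd, or [e] is odd, and then [v] is even. Hence replacing
    [b] by [c b] preserves the sign [(-1)^(v b)]. *)
Lemma dvdz2_coprime_sub (v e c b : int) :
  (2 %| v * e)%Z -> coprimez c e -> (2 %| v * (c * b) - v * b)%Z.
Proof.
move=> ve_even co_ce.
have -> : v * (c * b) - v * b = v * b * (c - 1) by ring.
have [e_even|e_odd] := boolP (2 %| e)%Z; last first.
  have v_even : (2 %| v)%Z.
    by rewrite -(@Gauss_dvdzl _ _ e) // coprimezE prime_coprime.
  by rewrite -mulrA dvdz_mulr.
suff c_odd : ~~ (2 %| c)%Z by apply: dvdz_mull; lia.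
apply/negP => c_even; have : (2 %| gcdz c e)%Z by rewrite dvdz_gcd c_even.
by rewrite (eqP co_ce).
Qed.

(** * Stability of the defining relations *)

(** Apart from the evenness of [v e], the integer [v] occurs only in exponents of -1, so only its
    parity matters. *)
Lemma gen_jacobi_sums_ext (e : nat) (K : fieldType) (L : splittingFieldType K)
    (z : L) (p : K) (v v' : int) (E E' : int -> int -> L) :
  (2 %| v - v')%Z -> E =2 E' ->
  gen_jacobi_sums e z p v E -> gen_jacobi_sums e z p v' E'.
Proof.
move=> vv' EE' [p0 ve per sym refl zero norm exch gal].
split=> // *; rewrite -?EE' //.
- have : (2 %| (v - v') * e%:Z)%Z by apply: dvdz_mulr.
  by rewrite mulrBl; lia.
- rewrite refl; congr (_ * _); apply: eq_signz.
  by rewrite -mulrBl dvdz_mulr.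
- by rewrite zero.
- by rewrite norm.
- rewrite exch //; congr (_ * _ * _); apply: eq_signz.
  by rewrite -mulrBl dvdz_mulr.
- by rewrite gal.
Qed.

Lemma eq_mod_periodic (T : Type) (e : nat) (G : int -> T) (m n : int) :
  (forall k, G (k + e%:Z) = G k) -> (e%:Z %| m - n)%Z -> G m = G n.
Proof.
move=> per /dvdzP[k] /eqP; rewrite subr_eq => /eqP->.
elim: k n => [|k IH|k IH] n; first by rewrite mul0r add0r.
  by rewrite -addn1 PoszD mulrDl mul1r addrAC per.
rewrite -[in RHS]IH -[LHS]per; congr G.
by rewrite -addn1 PoszD; ring.
Qed.

(** Multiplication by the unit [c] preserves divisibility and non-divisibility by [e], and the signs
    agree by [dvdz2_coprime_sub]. *)
Lemma gen_jacobi_sums_twist (e : nat) (K : fieldType) (L : splittingFieldType K)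
    (z : L) (p : K) (v c : int) (E : int -> int -> L) :
  coprimez c e%:Z -> gen_jacobi_sums e z p v E ->
  gen_jacobi_sums e z p v (fun a b => E (c * a) (c * b)).
Proof.
move=> co_ce [p0 ve per sym refl zero norm exch gal].
have dvdc a : (e%:Z %| c * a)%Z = (e%:Z %| a)%Z.
  by rewrite Gauss_dvdzr // coprimez_sym.
have perM a b (k : int) : E (a + k * e) b = E a b.
  apply: (eq_mod_periodic (G := E^~ b)) => [m|]; first exact: (per m b).1.
  by rewrite addrAC subrr add0r dvdz_mull.
split=> // [a b|a b|a a0|a b a0 b0 ab0|a b x a0 ab0 ax0 abx0|a b x co_xe].
- by rewrite !mulrDr !perM (sym _ (_ + _)) perM (sym (c * b)).
- rewrite refl (eq_signz _ (dvdz2_coprime_sub b ve co_ce)).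
  by rewrite mulrDr !mulrN.
- by rewrite mulr0 zero // dvdc.
- by rewrite !mulrN norm // -?mulrDr dvdc.
- rewrite !mulrN exch // -?mulrDr ?dvdc //.
  by rewrite (eq_signz _ (dvdz2_coprime_sub (b + x) ve co_ce)).
- by rewrite gal // !(mulrCA c).
Qed.

(** Every relation is multiplicative except [gjs_zero], where the minus sign restores the value -1;
    in the quadratic relations this sign cancels. *)
Lemma gen_jacobi_sums_mul (e : nat) (K : fieldType) (L : splittingFieldType K)
    (z : L) (p1 p2 : K) (v1 v2 : int) (E1 E2 : int -> int -> L) :
  gen_jacobi_sums e z p1 v1 E1 -> gen_jacobi_sums e z p2 v2 E2 ->
  gen_jacobi_sums e z (p1 * p2) (v1 + v2) (fun a b => - E1 a b * E2 a b).
Proof.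
move=> [p0 ve per sym refl zero norm exch gal].
move=> [p0' ve' per' sym' refl' zero' norm' exch' gal'].
split=> // [|||a b|a b|a a0|a b a0 b0 ab0|a b x a0 ab0 ax0 abx0|a b x co_xe].
- by rewrite mulf_neq0.
- by rewrite mulrDl rpredD.
- by split; rewrite ?(per _ _).1 ?(per' _ _).1 ?(per _ _).2 ?(per' _ _).2.
- by rewrite sym sym'.
- by rewrite refl refl' mulrDl signzD; ring.
- by rewrite zero // zero' // opprK mul1r.
- by rewrite mulrACA mulrNN norm // norm' // -scalerAl mul1r scalerA.
- rewrite mulrACA mulrNN exch // exch' // mulrDl signzD; ring.
- by rewrite rmorphM rmorphN /= gal // gal'.
Qed.

Lemma coprimez_unit_Zp (e : nat) (d : {unit 'Z_e}) :
  (1 < e)%N -> coprimez (- (val d : nat)%:Z) e%:Z.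
Proof.
move=> e_gt1; rewrite coprimezE abszN !absz_nat coprime_sym -unitZpE //.
by rewrite natr_Zp; apply: (valP d).
Qed.

Lemma gen_jacobi_sums_dcomp (e : nat) (K : fieldType) (L : splittingFieldType K)
    (z : L) (d : {unit 'Z_e}) (p1 p2 : K) (v1 v2 : int)
    (E1 E2 : int -> int -> L) :
  (1 < e)%N ->
  gen_jacobi_sums e z p1 v1 E1 -> gen_jacobi_sums e z p2 v2 E2 ->
  gen_jacobi_sums e z (p1 * p2) (v1 + v2) (dcomp_jac z d E1 E2).
Proof.
move=> e_gt1 gjs1 gjs2; have co_de := coprimez_unit_Zp d e_gt1.
have := gen_jacobi_sums_mul (gen_jacobi_sums_twist co_de gjs1) gjs2.
apply: gen_jacobi_sums_ext; first by rewrite subrr.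
by move=> a b; rewrite /dcomp_jac (gjs_galois gjs1).
Qed.

(** * Fourier transform of a d-composition *)

Lemma exprz_Zp (e : nat) (L : fieldType) (z : L) (a n : int) (i : 'Z_e) :
  (1 < e)%N -> z ^+ e = 1 -> (e%:Z %| (i : nat)%:Z - n)%Z ->
  z ^ (a * (i : nat)%:Z) = z ^ (a * n).
Proof.
move=> e_gt1 ze1 dvd_in; apply: eq_exprz_mod ze1 _; first exact: ltnW.
by rewrite -mulrBr dvdz_mull.
Qed.

Lemma Zp_affineE (e : nat) (d s i : 'Z_e) : (1 < e)%N ->
  (e%:Z %| ((d * s + i)%R : nat)%:Z
           - ((d : nat)%:Z * (s : nat)%:Z + (i : nat)%:Z))%Z.
Proof.
move=> e_gt1; rewrite -[X in (Posz X %| _)%Z](Zp_cast e_gt1) /=.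
rewrite modnDml -PoszM -PoszD.
by rewrite -modz_nat -eqz_mod_dvd modz_mod.
Qed.

Lemma dft_dcomp (e : nat) (L : fieldType) (z : L) (d : {unit 'Z_e})
    (A B : 'M[L]_((Zp_trunc e).+2)) (a b : int) :
  (1 < e)%N -> e.-primitive_root z ->
  dft_mx z (dcomp_mx d A B) a b =
    dft_mx z A (- (val d : nat)%:Z * a) (- (val d : nat)%:Z * b) *
    dft_mx z B a b.
Proof.
move=> e_gt1 prim_z; have ze1 := prim_expr_order prim_z; set D : int := - _.
have z_neq0 : z != 0 by rewrite (prim_root_eq0 prim_z) -lt0n ltnW.
have zD x y s i :
    z ^ (x * (s : 'Z_e)%:Z + y * (i : 'Z_e)%:Z) =
    z ^ (x * s%:Z) * z ^ (y * i%:Z).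
  by rewrite expfzDr.
(* Translating the index by [d s] multiplies a one-dimensional transform at [c] by the power of [z]
   with exponent [- d c s]. *)
have shift (s : 'Z_e) (c : int) (G : 'Z_e -> L) :
    \sum_(i : 'Z_e) G (val d * s + i) * z ^ (c * (i : nat)%:Z) =
    z ^ (D * c * (s : nat)%:Z) * \sum_(i : 'Z_e) G i * z ^ (c * (i : nat)%:Z).
  rewrite [in RHS](reindex_inj (addrI (val d * s))) big_distrr /=.
  apply: eq_bigr => i _; rewrite mulrCA; congr (_ * _).
  rewrite (exprz_Zp c e_gt1 ze1 (Zp_affineE (val d) s i e_gt1)) -expfzDr //.
  by congr (_ ^ _); rewrite /D; ring.
rewrite /dft_mx.
transitivity (\sum_i \sum_j \sum_s \sum_t
    A s t * B (val d * s + i) (val d * t + j) *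
    (z ^ (a * i%:Z) * z ^ (b * j%:Z))).
  apply: eq_bigr => i _; apply: eq_bigr => j _; rewrite mxE zD big_distrl /=.
  by apply: eq_bigr => s _; rewrite big_distrl.
under eq_bigr => i _ do rewrite exchange_big /=.
rewrite exchange_big /= big_distrl /=; apply: eq_bigr => s _.
under eq_bigr => i _ do rewrite exchange_big /=.
rewrite exchange_big /= big_distrl /=; apply: eq_bigr => t _.
(* With [s] and [t] fixed, [shift] is applied to the sum over [j] and then to the sum over [i]. *)
transitivity (A s t * \sum_(i : 'Z_e) z ^ (a * (i : nat)%:Z) *
   \sum_(j : 'Z_e) B (val d * s + i) (val d * t + j) * z ^ (b * (j : nat)%:Z)).
  rewrite big_distrr; apply: eq_bigr => i _; rewrite !big_distrr.
  by apply: eq_bigr => j _ /=; ring.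
transitivity (A s t * \sum_(i : 'Z_e) (z ^ (D * b * t%:Z) *
   \sum_(j : 'Z_e) B (val d * s + i) j * z ^ (b * j%:Z)) * z ^ (a * i%:Z)).
  congr (_ * _); apply: eq_bigr => i _; rewrite mulrC; congr (_ * _).
  exact: (shift t b (B _)).
have /= -> := shift s a
  (fun i => z ^ (D * b * t%:Z) * \sum_(j : 'Z_e) B i j * z ^ (b * j%:Z)).
rewrite zD -!mulrA; congr (_ * (_ * _)); rewrite big_distrr /=.
apply: eq_bigr => i _; rewrite -!mulrA; congr (_ * _); rewrite big_distrl /=.
by apply: eq_bigr => j _; rewrite zD; ring.
Qed.

(** * Fourier inversion and the transform of [Cyc_mx] *)

Lemma prim_expz_eq1 (e : nat) (L : fieldType) (z : L) (n : int) :
  e.-primitive_root z -> (z ^ n == 1) = (e%:Z %| n)%Z.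
Proof.
move=> prim_z; have e_gt0 := prim_order_gt0 prim_z.
have e_neq0 : e%:Z != 0 by rewrite eqz_nat -lt0n.
have mod_ge0 := modz_ge0 n e_neq0.
have dvd_mod : (e%:Z %| n - (n %% e%:Z)%Z)%Z by rewrite -eqz_mod_dvd modz_mod.
rewrite (eq_exprz_mod e_gt0 (prim_expr_order prim_z) dvd_mod).
rewrite -[n in RHS](subrK (n %% e%:Z)%Z) rpredDl //.
by rewrite -(gez0_abs mod_ge0) -exprnP -(prim_order_dvd prim_z).
Qed.

(** Orthogonality of the characters of Z/eZ: unless [z ^ n] is 1, the geometric sum times
    [z ^ n - 1] is [z ^ (n e) - 1], that is 0. *)
Lemma sum_prim_expz (e : nat) (L : fieldType) (z : L) (n : int) :
  e.-primitive_root z ->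
  \sum_(i < e) z ^ (n * (i : nat)%:Z) = if (e%:Z %| n)%Z then e%:R else 0.
Proof.
move=> prim_z; have ze1 := prim_expr_order prim_z.
under eq_bigr => i _ do rewrite -exprz_exp -exprnP.
rewrite -(prim_expz_eq1 n prim_z); case: eqP => [-> | /eqP zn_neq1].
  by under eq_bigr => i _ do rewrite expr1n; rewrite sumr_const card_ord.
apply: (mulfI (x := z ^ n - 1)); first by rewrite subr_eq0.
rewrite -subrX1 mulr0 exprnP exprz_exp mulrC -exprz_exp -exprnP ze1 exp1rz.
exact: subrr.
Qed.

Lemma sum_Zp (e : nat) (V : nmodType) (F : nat -> V) :
  (1 < e)%N -> \sum_(i : 'Z_e) F i = \sum_(i < e) F i.
Proof.
by move=> e_gt1; rewrite -(big_mkord xpredT F) Zp_cast // big_mkord.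
Qed.

(** After exchanging the sums, orthogonality keeps only the index [k] congruent to [a] modulo [e];
    periodicity then replaces [G k] by [G a]. *)
Lemma fourier_inversion (e : nat) (L : fieldType) (z : L) (G : int -> L)
    (a : int) :
  (1 < e)%N -> e.-primitive_root z -> (forall k, G (k + e%:Z) = G k) ->
  \sum_(i : 'Z_e) (\sum_(k < e) z ^ (- ((k : nat)%:Z * (i : nat)%:Z)) * G k%:Z)
      * z ^ (a * (i : nat)%:Z) = e%:R * G a.
Proof.
move=> e_gt1 prim_z per; have ze1 := prim_expr_order prim_z.
have e_gt0 := ltnW e_gt1.
have z_neq0 : z != 0 by rewrite (prim_root_eq0 prim_z) -lt0n ltnW.
pose F i :=
  (\sum_(k < e) z ^ (- ((k : nat)%:Z * i%:Z)) * G k%:Z) * z ^ (a * i%:Z).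
rewrite (sum_Zp F e_gt1) /F.
have e_neq0 : e%:Z != 0 by rewrite eqz_nat -lt0n.
have mod_ge0 := modz_ge0 a e_neq0.
have a_lt : (`|(a %% e%:Z)%Z|%N < e)%N by rewrite -ltz_nat gez0_abs // ltz_pmod.
pose a0 := Ordinal a_lt.
transitivity (\sum_(k < e) G k%:Z * \sum_(i < e) z ^ ((a - k%:Z) * i%:Z)).
  under eq_bigr => i _ do rewrite big_distrl /=.
  rewrite exchange_big; apply: eq_bigr => k _; rewrite big_distrr.
  apply: eq_bigr => i _ /=; rewrite mulrBl addrC expfzDr //; ring.
rewrite (bigD1 a0) //= [X in _ + X]big1 => [|k k_neq]; rewrite sum_prim_expz //.
  rewrite -eqz_mod_dvd gez0_abs // modz_mod eqxx addr0 mulrC; congr (_ * _).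
  by apply: eq_mod_periodic per _; rewrite -eqz_mod_dvd modz_mod.
rewrite -eqz_mod_dvd ifN ?mulr0 //; apply: contra k_neq => /eqP ak.
apply/eqP/val_inj => /=; rewrite ak modz_small //.
by rewrite /= ltz_nat ltn_ord.
Qed.

(** The delta terms cancel, so [Cyc_mx] is an inverse two-dimensional transform, undone by inversion
    first in the columns, then in the rows. *)
Lemma dft_Cyc (e : nat) (K : fieldType) (L : splittingFieldType K)
    (z : L) (p : K) (v : int) (E : int -> int -> L) (a b : int) :
  (1 < e)%N -> e.-primitive_root z -> e%:R != 0 :> L ->
  gen_jacobi_sums e z p v E ->
  dft_mx z (Cyc_mx e z p v E) a b = (-1) ^ (v * a) * E a b.
Proof.
move=> e_gt1 prim_z e_neq0 gjs; have ze1 := prim_expr_order prim_z.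
have z_neq0 : z != 0 by rewrite (prim_root_eq0 prim_z) -lt0n ltnW.
(* Each of the two inversions contributes one factor [e]. *)
apply: (mulfI (x := e%:R ^+ 2)); first by rewrite expf_neq0.
(* [G] is what inversion in the column index leaves as a function of the row frequency. Its sign has
   period [e] because [v e] is even. *)
pose G k := (-1) ^ (v * k) * (e%:R * E k b).
have perG k : G (k + e%:Z) = G k.
  rewrite /G (gjs_periodic gjs _ _).1; congr (_ * _); apply: eq_signz.
  by rewrite mulrDr addrAC subrr add0r (gjs_even gjs).
rewrite /dft_mx big_distrr /=.
transitivity (\sum_(i : 'Z_e)
  (\sum_(k < e) z ^ (- ((k : nat)%:Z * (i : nat)%:Z)) * G k%:Z)
    * z ^ (a * (i : nat)%:Z)).
  apply: eq_bigr => i _; rewrite big_distrr big_distrl /=.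
  transitivity (\sum_(k < e) z ^ (- (k%:Z * i%:Z)) * ((-1) ^ (v * k%:Z) *
    \sum_(j : 'Z_e)
      (\sum_(l < e) z ^ (- (l%:Z * j%:Z)) * E k l) * z ^ (b * j%:Z))
    * z ^ (a * i%:Z)); last first.
    apply: eq_bigr => k _; rewrite (fourier_inversion b e_gt1 prim_z) //.
    by move=> l; rewrite (gjs_periodic gjs _ _).2.
  under [RHS]eq_bigr => k _ do rewrite !(big_distrr, big_distrl) /=.
  rewrite exchange_big; apply: eq_bigr => j _ /=.
  rewrite !mxE addrAC addNr add0r 2!mulrA mulfV ?expf_neq0 // mul1r.
  rewrite big_distrl; apply: eq_bigr => k _ /=.
  rewrite !(big_distrr, big_distrl) /=; apply: eq_bigr => l _.
  by rewrite expfzDr // PoszD !PoszM opprD expfzDr //; ring.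
by rewrite (fourier_inversion a e_gt1 prim_z perG) /G; ring.
Qed.

(** Stated for any matrices with the prescribed transforms, so that it serves both [Cyc_mx] and the
    cyclotomic numbers. *)
Lemma dft_dcomp_jac (e : nat) (K : fieldType) (L : splittingFieldType K)
    (z : L) (d : {unit 'Z_e}) (p1 : K) (v1 v2 : int) (E1 E2 : int -> int -> L)
    (a b : int) :
  (1 < e)%N -> e.-primitive_root z ->
  gen_jacobi_sums e z p1 v1 E1 ->
  forall A1 A2 : 'M_((Zp_trunc e).+2),
  (forall a b, dft_mx z A1 a b = (-1) ^ (v1 * a) * E1 a b) ->
  (forall a b, dft_mx z A2 a b = (-1) ^ (v2 * a) * E2 a b) ->
  (-1) ^ ((v1 + v2) * a + 1) * dft_mx z (dcomp_mx d A1 A2) a b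
    = dcomp_jac z d E1 E2 a b.
Proof.
move=> e_gt1 prim_z gjs1 A1 A2 dft1 dft2.
have co_de := coprimez_unit_Zp d e_gt1.
rewrite dft_dcomp // dft1 dft2.
(* The first transform is taken at [- d a], where its sign is the same as at [a]; all signs then
   occur squared, except for the -1 coming from the [+ 1] in the exponent. *)
rewrite (eq_signz _ (dvdz2_coprime_sub a (gjs_even gjs1) co_de)).
rewrite /dcomp_jac (gjs_galois gjs1) // mulrDl !signzD expr1z.
have sq v : (-1) ^ v * (-1) ^ v = 1 :> L.
  by rewrite -signzD (@eq_signz _ _ 0) // subr0; lia.
move: (sq (v1 * a)) (sq (v2 * a)); move: ((-1) ^ _) ((-1) ^ _) => s1 s2 s11 s22.
set D : int := - _.
transitivity (s1 * s1 * (s2 * s2) * (- E1 (D * a) (D * b) * E2 a b)).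
  by ring.
by rewrite s11 s22 !mul1r.
Qed.

(** * Automorphisms of the cyclotomic field over the rationals *)

(* [minPoly 1 z] has a complex root [w], and an automorphism of [algC] maps [w]
   to [w ^+ k]; irreducibility carries this back to [z]. *)
Lemma root_minPoly_prim_exp (e k : nat) (L : fieldExtType rat) (z : L) :
  e.-primitive_root z -> coprime k e -> root (minPoly 1%AS z) (z ^+ k).
Proof.
move=> prim_z co_ke; have /polyOver1P[P defP] := minPolyOver 1%AS z.
have P_dvd : P %| 'X^e - 1.
  rewrite -(dvdp_map (in_alg L)) -defP rmorphB rmorphXn rmorph1 /= map_polyX.
  apply: minPoly_dvdp; last by rewrite /root !hornerE prim_expr_order ?subrr.
  by rewrite rpredB ?rpredX ?polyOverX ?rpred1.
have [w Pw0] : exists w : algC, root (map_poly ratr P) w.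
  apply/closed_rootP; rewrite size_map_poly -(size_map_poly (in_alg L)) -defP.
  rewrite gtn_eqF // (root_size_gt1 _ (root_minPoly 1%AS z)) //.
  by rewrite monic_neq0 ?monic_minPoly.
have we1 : w ^+ e = 1.
  have : root (map_poly ratr ('X^e - 1)) w.
    by apply: root_dvdp Pw0; rewrite dvdp_map.
  rewrite rmorphB rmorphXn rmorph1 /= map_polyX /root !hornerE subr_eq0.
  by move/eqP.
have [m [min_m mon_m] root_m] := minCpolyP w.
have m_dvd : m %| P by rewrite -root_m.
(* [m] divides the irreducible [P], and it is not constant since [w] is a root of it. *)
have dvd_m : P %| m.
  have m_over : map_poly (in_alg L) m \is a polyOver 1%AS.
    by apply/polyOver1P; exists m.
  have : map_poly (in_alg L) m %| minPoly 1%AS z by rewrite defP dvdp_map.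
  case/(minPoly_irr m_over)/orP => [|].
    by rewrite defP eqp_map => /andP[].
  rewrite -size_poly_eq1 size_map_poly => /eqP size_m.
  have : root (map_poly ratr m) w by rewrite root_m.
  have /eqP m_lead := mon_m; rewrite lead_coefE size_m /= in m_lead.
  by rewrite (size1_polyC (eq_leq size_m)) m_lead !rmorph1 (negPf (root1 w)).
have Pwk0 : root (map_poly ratr P) (w ^+ k).
  have [u uE] := Qn_aut_exists co_ke.
  have uP : map_poly u (map_poly ratr P) = map_poly ratr P.
    by rewrite -map_poly_comp; apply: eq_map_poly => x /=; apply: fmorph_rat.
  by rewrite -(uE w we1) -uP fmorph_root.
(* That [w ^+ k] is a root of [P] becomes a divisibility between rational polynomials, which can be
   evaluated at [z]. *)
have : P %| P \Po 'X^k.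
  apply: dvdp_trans dvd_m _; rewrite -root_m map_comp_poly rmorphXn /= map_polyX.
  by rewrite /root horner_comp !hornerE.
rewrite -(dvdp_map (in_alg L)) map_comp_poly rmorphXn /= map_polyX -defP.
move/dvdpP=> [Q defQ]; rewrite /root.
have -> : (minPoly 1%AS z).[z ^+ k] = ((minPoly 1%AS z) \Po 'X^k).[z].
  by rewrite horner_comp !hornerE.
by rewrite defQ hornerM minPolyxx mulr0.
Qed.

(** Over the rationals the [pick] in [sigma] succeeds: [z ^ c] is a conjugate of [z], and a
    splitting field is normal. *)
Lemma sigma_prim_root (e : nat) (L : splittingFieldType rat) (z : L) (c : int) :
  e.-primitive_root z -> coprimez c e%:Z -> sigma z c z = z ^ c.
Proof.
move=> prim_z co_ce; rewrite /sigma; case: pickP => [s /eqP //|no_s].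
have e_neq0 : e%:Z != 0 by rewrite eqz_nat -lt0n (prim_order_gt0 prim_z).
pose k := `|(c %% e%:Z)%Z|%N.
have kE : k%:Z = (c %% e%:Z)%Z by rewrite gez0_abs // modz_ge0.
have zk : z ^ c = z ^+ k.
  rewrite exprnP; have ze1 := prim_expr_order prim_z.
  apply: eq_exprz_mod (prim_order_gt0 prim_z) ze1 _.
  by rewrite -eqz_mod_dvd kE modz_mod.
have co_ke : coprime k e.
  by move: co_ce; rewrite /coprimez -gcdz_modl -kE /gcdz eqz_nat.
have [||||s _ sz] := @normalField_root_minPoly _ L 1%AS {:L}%AS z (z ^+ k).
- exact: subvf.
- exact: normalFieldf.
- exact: memvf.
- exact: (root_minPoly_prim_exp prim_z co_ke).
by have := no_s s; rewrite sz zk eqxx.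
Qed.

(** * Sums over the multiplicative group of a finite field *)

Lemma big_ord_mul (V : nmodType) (e f : nat) (G : nat -> V) :
  \sum_(k < e * f) G k = \sum_(v < f) \sum_(i < e) G (e * v + i)%N.
Proof.
rewrite -(big_mkord xpredT G).
elim: f => [|f IH]; first by rewrite muln0 big_ord0 big_geq.
rewrite big_ord_recr -IH /= mulnS addnC.
rewrite (@big_cat_nat _ _ _ (e * f)) ?leq_addr //=.
congr (_ + _); rewrite -{1}[(e * f)%N]add0n big_addn addKn big_mkord.
by apply: eq_bigr => i _; rewrite addnC.
Qed.

Lemma sum_generator (F : finFieldType) (V : nmodType) (g : {unit F})
    (H : F -> V) :
  generator [set: {unit F}] g ->
  \sum_(x | x != 0) H x = \sum_(k < #|F|.-1) H (val g ^+ k).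
Proof.
move=> gen_g.
(* As [x] is nonzero, the default [1%g] of [insubd] is not returned. *)
have val_insubd x : x != 0 -> val (insubd (1%g : {unit F}) x) = x.
  by move=> x_neq0; rewrite insubdK // unitfE.
rewrite (reindex_onto _ _ val_insubd) /=.
have og : #[g]%g = #|F|.-1 by rewrite -card_finField_unit (eqP gen_g).
pose h (k : 'I_#|F|.-1) := (g ^+ k)%g.
have inj_h : injective h.
  move=> i j /eqP; rewrite eq_expg_mod_order og !modn_small // => /eqP.
  exact: val_inj.
have [h' hK h'K] : bijective h.
  by apply: inj_card_bij inj_h _; rewrite -cardsT card_finField_unit card_ord.
rewrite (reindex h); last by exists h' => i _; [exact: hK | exact: h'K].
apply: eq_big => [k|k _]; last by rewrite /h FinRing.val_unitX.
by rewrite -unitfE valKd eqxx andbT; apply: (valP (h k)).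
Qed.

(** * Characters and Jacobi sums of a finite field *)

Section Jacobi.

Variables (e : nat) (F : finFieldType) (L : fieldType) (z : L).
Variables (g : {unit F}) (chi : F -> L).
Hypothesis prim_z : e.-primitive_root z.
Hypothesis gen_g : generator [set: {unit F}] g.
Hypothesis chiP : is_power_char g z chi.

Let chi1 : chi 1 = 1. Proof. by case: chiP => -[]. Qed.
Let chiM : {morph chi : x y / x * y}. Proof. by case: chiP => -[]. Qed.

Lemma power_char_gen k : chi (val g ^+ k) = z ^+ k.
Proof.
by elim: k => [|k IH]; rewrite ?chi1 // !exprS chiM IH; case: chiP => _ _ ->.
Qed.

Lemma power_char_root x : x != 0 -> exists k, chi x = z ^+ k.
Proof.
move=> x_neq0; have Ux : x \is a GRing.unit by rewrite unitfE.
have : Sub x Ux \in <[g]>%g by rewrite -(eqP gen_g) inE.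
case/cycleP => k /(congr1 val); rewrite FinRing.val_unitX /= => ->.
by exists k; apply: power_char_gen.
Qed.

Lemma power_char_neq0 x : x != 0 -> chi x != 0.
Proof.
move=> /mulfV xV; apply: contraTneq (oner_neq0 L) => x0.
by rewrite -chi1 -xV chiM x0 mul0r eqxx.
Qed.

(* The test is needed because [0 ^ 0 = 1]. *)
Definition char_pow (a : int) (x : F) : L := if x == 0 then 0 else chi x ^ a.

Local Notation X := char_pow.

Lemma char_pow0 a : X a 0 = 0. Proof. by rewrite /X eqxx. Qed.

Lemma char_pow1 a : X a 1 = 1. Proof. by rewrite /X oner_eq0 chi1 exp1rz. Qed.

Lemma char_powM a x y : X a (x * y) = X a x * X a y.
Proof.
rewrite /X mulf_eq0; case: eqP => _; first by rewrite mul0r.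
by case: eqP => _; rewrite ?mulr0 // chiM expfzMl.
Qed.

Lemma char_powD a b x : X (a + b) x = X a x * X b x.
Proof.
rewrite /X; case: eqP => [_|/eqP x_neq0]; first by rewrite mul0r.
by rewrite expfzDr ?power_char_neq0.
Qed.

Lemma char_pow_dvd a x : (e%:Z %| a)%Z -> X a x = (x != 0)%:R.
Proof.
rewrite /X => /dvdzP[k ->]; case: eqP => // /eqP /power_char_root[n ->].
rewrite exprnP exprz_exp; apply/eqP.
by rewrite (prim_expz_eq1 _ prim_z) mulrA dvdz_mull.
Qed.

Lemma char_pow_gen a k : X a (val g ^+ k) = z ^ (a * k%:Z).
Proof.
rewrite /X expf_eq0 (negPf (_ : val g != 0)) ?andbF; last first.
  by rewrite -unitfE; apply: (valP g).
by rewrite power_char_gen exprnP exprz_exp mulrC.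
Qed.

Lemma char_powN a x : X (- a) x = X a x^-1.
Proof.
rewrite /X invr_eq0; case: eqP => // /eqP x0; rewrite -exprz_inv; congr (_ ^ _).
apply: (mulfI (power_char_neq0 x0)).
by rewrite mulfV ?power_char_neq0 // -chiM mulfV.
Qed.

(** Substituting [g x] for [x] multiplies the sum by [X a g], which differs from 1. *)
Lemma sum_char_pow a : ~~ (e%:Z %| a)%Z -> \sum_x X a x = 0.
Proof.
move=> a_ndvd; have g0 : val g != 0 by rewrite -unitfE; apply: (valP g).
have Xg : X a (val g) != 1.
  by rewrite -[val g]expr1 char_pow_gen mulr1 (prim_expz_eq1 _ prim_z).
apply: (mulfI (x := X a (val g) - 1)); first by rewrite subr_eq0.
rewrite mulr0 mulrBl mul1r [X in _ - X](reindex_inj (mulfI g0)) big_distrr /=.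
by rewrite -sumrB big1 // => x _; rewrite char_powM subrr.
Qed.

Lemma sum_char_pow_dvd a : (e%:Z %| a)%Z -> \sum_x X a x = #|F|%:R - 1.
Proof.
move=> a_dvd; under eq_bigr => x _ do rewrite char_pow_dvd //.
rewrite -natr_sum -big_mkcond sum1_card.
rewrite (cardD1 0 F) inE add1n -natr1 addrK; congr (_%:R).
by apply: eq_card => x; rewrite !inE andbT.
Qed.

(** Since [char_pow] vanishes at 0 for every exponent, the sum extends to the whole field, where it
    can be reindexed freely. *)
Lemma jacobi_sumE a b : jacobi_sum chi a b = \sum_x X a x * X b (1 - x).
Proof.
rewrite /jacobi_sum big_mkcond; apply: eq_bigr => x _.
rewrite /X subr_eq0 (eq_sym 1); case: eqP => [_|_]; first by rewrite mul0r.
by case: eqP; rewrite ?mulr0.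
Qed.

Local Notation J := (jacobi_sum chi).

Lemma jacobi_sumC a b : J a b = J b a.
Proof.
rewrite !jacobi_sumE (reindex_inj (inv_inj (subKr 1))).
by apply: eq_bigr => x _; rewrite subKr mulrC.
Qed.

Lemma jacobi_sum_periodic a b c : (e%:Z %| c)%Z -> J (a + c) b = J a b.
Proof.
move=> c_dvd; rewrite !jacobi_sumE; apply: eq_bigr => x _.
rewrite char_powD (char_pow_dvd _ c_dvd) /X.
by case: eqP => _; rewrite ?mulr1 ?mulr0.
Qed.

(** The factor [X 0 (1 - x)] only removes the term at [x = 1], which is 1, from a complete character
    sum, which is 0. *)
Lemma jacobi_sum0 a : ~~ (e%:Z %| a)%Z -> J a 0 = - 1.
Proof.
move=> a_ndvd; rewrite jacobi_sumE; apply/eqP; rewrite -addr_eq0; apply/eqP.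
rewrite -[RHS](sum_char_pow a_ndvd) [RHS](bigD1 1) //= char_pow1 addrC.
congr (_ + _); rewrite (bigD1 1) //= subrr char_pow0 mulr0 add0r.
apply: eq_bigr => x x1; rewrite (char_pow_dvd _ (dvdz0 _)).
by rewrite subr_eq0 eq_sym x1 mulr1.
Qed.

(** Substitute [x^-1] for [x] and use [1 - x^-1 = - (1 - x) x^-1]. *)
Lemma jacobi_sum_refl a b : J a b = X b (- 1) * J (- a - b) b.
Proof.
rewrite !jacobi_sumE (reindex_inj invr_inj) big_distrr /=.
apply: eq_bigr => x _; have [->|x0] := eqVneq x 0.
  by rewrite invr0 !char_pow0 !mul0r mulr0.
rewrite -char_powN char_powD -mulrA mulrCA; congr (_ * _).
rewrite char_powN -!char_powM; congr (X b _).
by rewrite mulN1r -mulrN opprB mulrBr mulr1 mulVf.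
Qed.

(** For nonzero [t], scale [x] by [t]. At [t = 0] the sum is a multiple of the complete sum of
    [X (a + b)], which vanishes by the hypothesis. *)
Lemma conv_char_pow a b t : ~~ (e%:Z %| a + b)%Z ->
  \sum_x X a x * X b (t - x) = X (a + b) t * J a b.
Proof.
move=> ab_ndvd; have [->|t0] := eqVneq t 0.
  rewrite char_pow0 mul0r; transitivity ((\sum_x X (a + b) x) * X b (- 1)).
    rewrite big_distrl; apply: eq_bigr => x _ /=.
    by rewrite sub0r -(mulN1r x) char_powM char_powD; ring.
  by rewrite sum_char_pow // mul0r.
rewrite (reindex_inj (mulfI t0)) jacobi_sumE big_distrr.
apply: eq_bigr => x _ /=.
by rewrite -[t in t - _]mulr1 -mulrBr !char_powM char_powD; ring.
Qed.

(** The degenerate convolution, whose exponents add up to 0: it contains a point mass at [t = 0],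
    the source of the factor [#|F|] in [jacobi_sum_norm]. *)
Lemma conv_char_pow_opp b t : ~~ (e%:Z %| b)%Z ->
  \sum_x X b x * X (- b) (t - x) = X b (- 1) * (#|F|%:R *+ (t == 0) - 1).
Proof.
move=> b_ndvd; have [->|t0] := eqVneq t 0.
  have b_dvd : (e%:Z %| b - b)%Z by rewrite subrr dvdz0.
  rewrite mulr1n -(sum_char_pow_dvd b_dvd) big_distrr; apply: eq_bigr => x _ /=.
  rewrite sub0r -(mulN1r x) char_powM char_powD (char_powN b (- 1)) invrN1.
  ring.
rewrite mulr0n sub0r (reindex_inj (mulfI t0)).
transitivity (J b (- b)).
  rewrite jacobi_sumE; apply: eq_bigr => x _.
  rewrite -[t in t - _]mulr1 -mulrBr !char_powM mulrACA -char_powD subrr.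
  by rewrite (char_pow_dvd _ (dvdz0 _)) t0 mul1r.
rewrite jacobi_sumC jacobi_sum_refl opprK subrr jacobi_sumC jacobi_sum0 //.
Qed.

(* Both sides are the value at [1] of the convolution of [X a], [X b], [X c]. *)
Lemma jacobi_sum_exchange a b c :
  ~~ (e%:Z %| a + b)%Z -> ~~ (e%:Z %| a + c)%Z ->
  J a b * J (a + b) c = J a c * J (a + c) b.
Proof.
pose S b c := \sum_x \sum_y X a x * X b y * X c (1 - x - y).
(* [X (a + b') t * J a b'] is a convolution at [t]; the substitution [t = x + y] makes the triple
   sum appear. *)
have SE b' c' : ~~ (e%:Z %| a + b')%Z -> J a b' * J (a + b') c' = S b' c'.
  move=> ab_ndvd; rewrite mulrC jacobi_sumE big_distrl /=.
  under eq_bigr => t _ do rewrite mulrAC -conv_char_pow // big_distrl /=.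
  rewrite exchange_big; apply: eq_bigr => x _ /=.
  rewrite (reindex_inj (addrI x)); apply: eq_bigr => y _ /=.
  by rewrite addrAC subrr add0r opprD addrA.
move=> ab_ndvd ac_ndvd; rewrite !SE //; apply: eq_bigr => x _.
(* This exchanges [y] with [1 - x - y]. *)
rewrite (reindex_inj (inv_inj (subKr (1 - x)))); apply: eq_bigr => y _.
by rewrite subKr mulrAC.
Qed.

(** Reflecting the second factor gives the triple convolution of [X a], [X b] and [X (- b)] at 1. By
    [conv_char_pow_opp] only [x = 1] contributes, up to a vanishing sum of [X a]. *)
Lemma jacobi_sum_norm a b :
  ~~ (e%:Z %| a)%Z -> ~~ (e%:Z %| b)%Z -> ~~ (e%:Z %| a + b)%Z ->
  J a b * J (- a) (- b) = #|F|%:R.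
Proof.
move=> a_ndvd b_ndvd ab_ndvd.
have sq : X b (- 1) * X b (- 1) = 1.
  by rewrite -char_powM mulrNN mulr1 char_pow1.
have -> : J (- a) (- b) = X b (- 1) * J (a + b) (- b).
  by rewrite (jacobi_sum_refl (- a)) !opprK char_powN invrN1.
rewrite mulrCA jacobi_sumE.
suff -> : (\sum_x X a x * X b (1 - x)) * J (a + b) (- b) = X b (- 1) * #|F|%:R.
  by rewrite mulrA sq mul1r.
rewrite -jacobi_sumE mulrC (jacobi_sumE (a + b)) big_distrl /=.
under eq_bigr => t _ do rewrite mulrAC -conv_char_pow // big_distrl /=.
rewrite exchange_big /=.
transitivity (\sum_x X a x * (X b (- 1) * (#|F|%:R *+ (1 - x == 0) - 1))).
  apply: eq_bigr => x _; rewrite -conv_char_pow_opp // big_distrr /=.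
  rewrite (reindex_inj (addrI x)); apply: eq_bigr => y _ /=.
  by rewrite addrAC subrr add0r opprD addrA mulrA.
under eq_bigr => x _ do rewrite mulrCA mulrBr mulr1.
rewrite -big_distrr sumrB sum_char_pow // subr0; congr (_ * _).
rewrite (bigD1 1) //= subrr eqxx char_pow1 mul1r big1 ?addr0 // => x x1.
by rewrite subr_eq0 eq_sym (negPf x1) mulr0n mulr0.
Qed.

Lemma char_powN1 (w b : int) :
  chi (- 1) = (- 1) ^ w -> X b (- 1) = (- 1) ^ (w * b).
Proof. by rewrite /X oppr_eq0 oner_eq0 => ->; rewrite exprz_exp. Qed.

End Jacobi.

(** * Jacobi sums as generalized Jacobi sums *)

(** Off 0 the values of [chi] are powers of [z], so [sigma] raises them to the power [c]. *)
Lemma sigma_jacobi_sum (F : finFieldType) (K : fieldType)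
    (L : splittingFieldType K) (z : L) (g : {unit F}) (chi : F -> L)
    (a b c : int) :
  generator [set: {unit F}] g -> is_power_char g z chi ->
  sigma z c z = z ^ c ->
  sigma z c (jacobi_sum chi a b) = jacobi_sum chi (c * a) (c * b).
Proof.
move=> gen_g chiP sig; rewrite /jacobi_sum rmorph_sum.
apply: eq_bigr => x /andP[x0 x1] /=.
have sigX y n : y != 0 -> sigma z c (chi y ^ n) = chi y ^ (c * n).
  move=> y0; rewrite fmorphXz -exprz_exp; congr (_ ^ _).
  have [k ->] := power_char_root gen_g chiP y0.
  by rewrite rmorphXn /= sig !exprnP !exprz_exp mulrC.
by rewrite rmorphM /= !sigX // subr_eq0 eq_sym.
Qed.

(** Reflection gives both factors with negated first argument the first argument [a + c]; what
    remains is [jacobi_sum_exchange] at [(a + c, - c, b)]. *)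
Lemma jacobi_sum_exchange_opp (e : nat) (F : finFieldType) (L : fieldType)
    (z : L) (g : {unit F}) (chi : F -> L) (w a b c : int)
    (J := jacobi_sum chi) :
  e.-primitive_root z -> is_power_char g z chi -> chi (- 1) = (- 1) ^ w ->
  ~~ (e%:Z %| a)%Z -> ~~ (e%:Z %| a + b + c)%Z ->
  J a b * J (- a) (- c) =
    (- 1) ^ (w * (b + c)) * J (- (a + b + c)) b * J (a + b + c) (- c).
Proof.
rewrite /J => {J} prim_z chiP chiN1 a0 abc0.
have refl x y := jacobi_sum_refl chiP x y.
have reflN x y : jacobi_sum chi (- x) y =
    (- 1) ^ (w * y) * jacobi_sum chi (x - y) y.
  by rewrite refl (char_powN1 _ chiN1) opprK.
have := jacobi_sum_exchange prim_z chiP (a := a + c) (b := - c) (c := b).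
rewrite addrK addrAC => /(_ a0 abc0) exch.
have sq x : (- 1) ^ x * (- 1) ^ x = 1 :> L.
  by rewrite -signzD (@eq_signz _ _ 0) // subr0; lia.
rewrite !reflN opprK (_ : a + b + c - b = a + c); last by ring.
rewrite mulrDr signzD (@eq_signz _ (w * - c) (w * c)); last first.
  by rewrite mulrN; lia.
move: (sq (w * b)) exch.
move: ((-1) ^ (w * b)) ((-1) ^ (w * c)) => s1 s2.
move=> sq1 exch; rewrite mulrCA (mulrC (jacobi_sum chi a b)) exch.
rewrite -[LHS]mul1r -sq1 -!mulrA; congr (s1 * _).
by rewrite mulrCA.
Qed.

(** Tying [w] only to [chi (- 1)] and to the evenness of [w e] treats odd and even characteristic
    together. *)
Lemma gen_jacobi_sums_jacobi (e : nat) (F : finFieldType) (K : fieldType)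
    (L : splittingFieldType K) (z : L) (g : {unit F}) (chi : F -> L) (w : int) :
  e.-primitive_root z -> generator [set: {unit F}] g -> is_power_char g z chi ->
  (forall c, coprimez c e%:Z -> sigma z c z = z ^ c) ->
  (2 %| w * e%:Z)%Z -> chi (- 1) = (- 1) ^ w -> #|F|%:R != 0 :> K ->
  gen_jacobi_sums e z #|F|%:R w (jacobi_sum chi).
Proof.
move=> prim_z gen_g chiP sig we_even chiN1 F0.
have perl a b : jacobi_sum chi (a + e%:Z) b = jacobi_sum chi a b.
  exact: (jacobi_sum_periodic prim_z gen_g chiP).
split=> [||a b|a b|a b|a a0|a b a0 b0 ab0|a b c a0 _ _ abc0|a b c co_ce].
- exact: F0.
- exact: we_even.
- by split; rewrite ?perl // jacobi_sumC perl jacobi_sumC.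
- exact: jacobi_sumC.
- by rewrite -(char_powN1 _ chiN1); exact: (jacobi_sum_refl chiP).
- exact: (jacobi_sum0 prim_z gen_g chiP a0).
- by rewrite (jacobi_sum_norm prim_z gen_g chiP a0 b0 ab0) scaler_nat.
- exact: (jacobi_sum_exchange_opp prim_z chiP chiN1 a0 abc0).
- exact: (sigma_jacobi_sum _ _ gen_g chiP (sig c co_ce)).
Qed.

(** * The value of the character at -1 *)

(** Here [e f] is even and -1 is the power of [g] with exponent [e f / 2], which [e] divides exactly
    when [f] is even. *)
Lemma power_charN1_odd (e f : nat) (F : finFieldType) (L : fieldType) (z : L)
    (g : {unit F}) (chi : F -> L) :
  e.-primitive_root z -> generator [set: {unit F}] g -> is_power_char g z chi ->
  #|F| = (e * f + 1)%N -> odd #|F| -> chi (- 1) = (- 1) ^ f%:Z.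
Proof.
move=> prim_z gen_g chiP cardF; rewrite cardF addn1 /= => ef_even.
have og : #[g]%g = (e * f)%N.
  by rewrite /order -(eqP gen_g) card_finField_unit cardF addn1.
have ef_gt0 : (0 < e * f)%N by rewrite -og order_gt0.
have efE : ((e * f)./2 * 2)%N = (e * f)%N by rewrite muln2 even_halfK.
have gN1 : val g ^+ (e * f)./2 = - 1.
  have : (val g ^+ (e * f)./2) ^+ 2 == 1.
    by rewrite -exprM efE -og -FinRing.val_unitX expg_order.
  rewrite sqrf_eq1 => /orP[|/eqP //].
  (* The value 1 would force the order [e f] of [g] to divide its own half. *)
  rewrite -FinRing.val_unitX -[1]/(val (1%g : {unit F})) (inj_eq val_inj).
  by rewrite -order_dvdn og => /dvdn_leq; lia.
rewrite -gN1 (power_char_gen chiP).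
have : (z ^+ (e * f)./2) ^+ 2 == 1.
  by rewrite -exprM efE exprM (prim_expr_order prim_z) expr1n.
have z1 : (z ^+ (e * f)./2 == 1) = ~~ odd f.
  have e_gt0 := prim_order_gt0 prim_z.
  rewrite -(prim_order_dvd prim_z) -(@dvdn_pmul2r 2) // efE dvdn_pmul2l //.
  by rewrite dvdn2.
rewrite sqrf_eq1 z1 -exprnP; case: (boolP (odd f)) => odd_f /=.
  by move/eqP->; rewrite -signr_odd odd_f.
by move=> _; apply/eqP; rewrite -signr_odd (negPf odd_f) z1.
Qed.

(** Here [e] is odd, and [chi (- 1)] is killed by both exponents 2 and [e]. *)
Lemma power_charN1_even (e f : nat) (F : finFieldType) (L : fieldType) (z : L)
    (g : {unit F}) (chi : F -> L) :
  e.-primitive_root z -> generator [set: {unit F}] g -> is_power_char g z chi ->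
  #|F| = (e * f + 1)%N -> ~~ odd #|F| -> chi (- 1) = 1.
Proof.
move=> prim_z gen_g chiP cardF.
rewrite cardF addn1 /= negbK oddM => /andP[odd_e _].
have [[[chi1 chiM] _ _]] := (chiP, tt).
have sq : chi (- 1) ^+ 2 = 1 by rewrite expr2 -chiM mulrNN mulr1.
have N10 : - 1 != 0 :> F by rewrite oppr_eq0 oner_eq0.
have [k chik] := power_char_root gen_g chiP N10.
have : chi (- 1) ^+ e = 1.
  by rewrite chik exprAC (prim_expr_order prim_z) expr1n.
by rewrite -(odd_double_half e) odd_e -mul2n exprD exprM sq expr1n mulr1.
Qed.

(** * Fourier transform of the cyclotomic numbers *)

Lemma dft_cyc_num (e f : nat) (F : finFieldType) (L : fieldType) (z : L)
    (g : {unit F}) (chi : F -> L) (w : int) (a b : int) :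
  (1 < e)%N ->
  e.-primitive_root z -> generator [set: {unit F}] g -> is_power_char g z chi ->
  #|F| = (e * f + 1)%N -> chi (- 1) = (- 1) ^ w ->
  dft_mx z (cyc_num_mx L e f g) a b = (- 1) ^ (w * a) * jacobi_sum chi a b.
Proof.
move=> e_gt1 prim_z gen_g chiP cardF chiN1.
rewrite -(char_powN1 _ chiN1) (jacobi_sumE chi).
set X := char_pow chi.
transitivity (\sum_(i < e) \sum_(j < e) (cyc_num e f g i j)%:R *
                z ^ (a * i%:Z + b * j%:Z)).
  rewrite /dft_mx -(sum_Zp (fun i => \sum_(j < e) (cyc_num e f g i j)%:R *
                z ^ (a * i%:Z + b * j%:Z))) //.
  apply: eq_bigr => i _; rewrite -(sum_Zp (fun j => (cyc_num e f g i j)%:R *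
                z ^ (a * i%:Z + b * j%:Z))) //.
  by apply: eq_bigr => j _; rewrite mxE.
have ze1 := prim_expr_order prim_z.
have z_neq0 : z != 0 by rewrite (prim_root_eq0 prim_z) -lt0n ltnW.
(* Characters of order dividing [e] see the exponent of [g] only modulo [e]. *)
have Xg c v i : X c (val g ^+ (e * v + i)) = z ^ (c * i%:Z).
  rewrite /X (char_pow_gen chiP) PoszD mulrDr expfzDr //.
  rewrite [X in X * _](_ : _ = 1) ?mul1r //.
  by apply/eqP; rewrite (prim_expz_eq1 _ prim_z) PoszM mulrCA dvdz_mulr.
have sum_g (H : F -> L) :
    \sum_(x | x != 0) H x = \sum_(i < e) \sum_(v < f) H (val g ^+ (e * v + i)).
  rewrite (sum_generator _ gen_g) cardF addn1 /=.
  by rewrite (big_ord_mul _ _ (fun k => H (val g ^+ k))) exchange_big.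
(* The cyclotomic number at [(i, j)] counts the solutions of [1 + x = y] with [x] in the class of
   [g ^+ i] and [y] in that of [g ^+ j]. *)
transitivity (\sum_(x | x != 0) \sum_(y | y != 0)
    (1 + x == y)%:R * (X a x * X b y)).
  rewrite sum_g; apply: eq_bigr => i _.
  under [RHS]eq_bigr => v _ do rewrite sum_g.
  rewrite exchange_big; apply: eq_bigr => j _ /=.
  rewrite pair_big /= /cyc_num -sum1_card big_mkcond natr_sum big_distrl /=.
  apply: eq_bigr => v _; rewrite inE !Xg expfzDr //; by case: eqP.
transitivity (\sum_x X a x * X b (1 + x)).
  rewrite big_mkcond; apply: eq_bigr => x _; have [->|x0] := eqVneq x 0.
    by rewrite /X char_pow0 mul0r.
  rewrite big_mkcond (bigD1 (1 + x)) //= big1 => [|y y1]; last first.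
    by case: ifP => // _; rewrite eq_sym (negPf y1) mul0r.
  rewrite eqxx mul1r addr0; case: eqP => //= ->; by rewrite /X char_pow0 mulr0.
(* Replacing [x] by [- x] produces the sign [X a (- 1)]. *)
rewrite (reindex_inj oppr_inj) big_distrr; apply: eq_bigr => x _ /=.
by rewrite mulrA /X -(char_powM chiP) mulN1r.
Qed.

(** * Prime powers and parities of the exponents *)

Lemma odd_prime_exp (p r : nat) :
  prime p -> (0 < r)%N -> odd (p ^ r) = (p != 2%N).
Proof.
move=> p_pr r_gt0; rewrite oddX eqn0Ngt r_gt0 /=.
case: (even_prime p_pr) => [-> //|p_odd]; rewrite p_odd; apply/esym.
by apply: contraTneq p_odd => ->.
Qed.

Lemma power_charN1 (e f p r : nat) (F : finFieldType) (L : fieldType) (z : L)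
    (g : {unit F}) (chi : F -> L) (w := if p == 2%N then 0%N else f) :
  e.-primitive_root z -> generator [set: {unit F}] g -> is_power_char g z chi ->
  prime p -> (0 < r)%N -> (p ^ r = e * f + 1)%N -> #|F| = (p ^ r)%N ->
  chi (- 1) = (- 1) ^ w%:Z /\ (2 %| w%:Z * e%:Z)%Z.
Proof.
move=> prim_z gen_g chiP p_pr r_gt0 pr_eq cardF; rewrite /w.
have oddF : odd #|F| = (p != 2%N) by rewrite cardF odd_prime_exp.
rewrite pr_eq in cardF; case: eqP oddF => [_|_] /= oddF.
  by rewrite (power_charN1_even prim_z gen_g chiP cardF) ?oddF // mul0r.
split; first exact: power_charN1_odd prim_z gen_g chiP cardF oddF.
by move: oddF; rewrite cardF; lia.
Qed.

Lemma pnatr_exp_neq0 (p r : nat) : prime p -> (p ^ r)%:R != 0 :> rat.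
Proof.
by move=> p_pr; rewrite Num.Theory.pnatr_eq0 -lt0n expn_gt0 prime_gt0.
Qed.

Lemma dft_dcomp_Cyc (e : nat) (K : fieldType) (L : splittingFieldType K)
    (z : L) (d : {unit 'Z_e}) (p1 p2 : K) (v1 v2 : int)
    (E1 E2 : int -> int -> L) (a b : int) :
  (1 < e)%N -> [pchar K] =i pred0 -> e.-primitive_root z ->
  gen_jacobi_sums e z p1 v1 E1 -> gen_jacobi_sums e z p2 v2 E2 ->
  (-1) ^ ((v1 + v2) * a + 1) *
    dft_mx z (dcomp_mx d (Cyc_mx e z p1 v1 E1) (Cyc_mx e z p2 v2 E2)) a b
  = dcomp_jac z d E1 E2 a b.
Proof.
move=> e_gt1 charK prim_z gjs1 gjs2.
have e_neq0 : e%:R != 0 :> L.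
  rewrite -(rmorph_nat (in_alg L)) fmorph_eq0 ((pcharf0P K).1 charK) -lt0n.
  exact: ltnW.
by apply: (dft_dcomp_jac d a b e_gt1 prim_z gjs1) => a' b'; apply: dft_Cyc.
Qed.

Lemma gen_jacobi_sums_power_char (e f p r : nat) (F : finFieldType)
    (L : splittingFieldType rat) (z : L) (g : {unit F}) (chi : F -> L)
    (w := if p == 2%N then 0%N else f) :
  e.-primitive_root z -> generator [set: {unit F}] g -> is_power_char g z chi ->
  prime p -> (0 < r)%N -> (p ^ r = e * f + 1)%N -> #|F| = (p ^ r)%N ->
  gen_jacobi_sums e z (p ^ r)%:R w%:Z (jacobi_sum chi).
Proof.
move=> prim_z gen_g chiP p_pr r_gt0 pr_eq cardF.
have [chiN1 w_even] := power_charN1 prim_z gen_g chiP p_pr r_gt0 pr_eq cardF.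
have sigz c := @sigma_prim_root e L z c prim_z.
have := gen_jacobi_sums_jacobi prim_z gen_g chiP sigz w_even chiN1.
by rewrite cardF; apply; apply: pnatr_exp_neq0.
Qed.

Lemma pred_mul_div (e m1 m2 f1 f2 : nat) :
  (0 < e)%N -> (m1 = e * f1 + 1)%N -> (m2 = e * f2 + 1)%N ->
  ((m1 * m2 - 1) %/ e = f1 * f2 * e + f1 + f2)%N.
Proof.
move=> e_gt0 -> ->; rewrite -[RHS](mulnK _ e_gt0); congr (_ %/ _)%N.
by rewrite mulnDr mulnDl !muln1 mul1n addnA addnK; lia.
Qed.

Lemma gen_jacobi_sums_dcomp_natr (e : nat) (K : fieldType)
    (L : splittingFieldType K) (z : L) (d : {unit 'Z_e}) (m1 m2 : nat)
    (v1 v2 v : int) (E1 E2 : int -> int -> L) :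
  (1 < e)%N -> (2 %| v1 + v2 - v)%Z ->
  gen_jacobi_sums e z m1%:R v1 E1 -> gen_jacobi_sums e z m2%:R v2 E2 ->
  gen_jacobi_sums e z (m1 * m2)%:R v (dcomp_jac z d E1 E2).
Proof.
move=> e_gt1 v_parity gjs1 gjs2; rewrite natrM.
apply: (gen_jacobi_sums_ext v_parity (fun _ _ => erefl)).
exact: gen_jacobi_sums_dcomp.
Qed.

Lemma dft_dcomp_cyc_num (e f1 f2 : nat) (K : fieldType)
    (L : splittingFieldType K) (z : L) (d : {unit 'Z_e}) (F1 F2 : finFieldType)
    (g1 : {unit F1}) (g2 : {unit F2}) (chi1 : F1 -> L) (chi2 : F2 -> L)
    (p1 : K) (w1 w2 w a b : int) :
  (1 < e)%N -> e.-primitive_root z ->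
  generator [set: {unit F1}] g1 -> generator [set: {unit F2}] g2 ->
  is_power_char g1 z chi1 -> is_power_char g2 z chi2 ->
  #|F1| = (e * f1 + 1)%N -> #|F2| = (e * f2 + 1)%N ->
  chi1 (- 1) = (- 1) ^ w1 -> chi2 (- 1) = (- 1) ^ w2 ->
  gen_jacobi_sums e z p1 w1 (jacobi_sum chi1) ->
  (2 %| w - (w1 + w2))%Z ->
  (- 1) ^ (w * a + 1) *
    dft_mx z (dcomp_mx d (cyc_num_mx L e f1 g1) (cyc_num_mx L e f2 g2)) a b
  = dcomp_jac z d (jacobi_sum chi1) (jacobi_sum chi2) a b.
Proof.
move=> e_gt1 prim_z gen1 gen2 chi1P chi2P card1 card2 chi1N1 chi2N1 gjs1 ww.
rewrite (@eq_signz _ _ ((w1 + w2) * a + 1)); last first.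
  by rewrite opprD addrACA subrr addr0 -mulrBl dvdz_mulr.
apply: (dft_dcomp_jac d a b e_gt1 prim_z gjs1) => a' b'.
  exact: (dft_cyc_num a' b' e_gt1 prim_z gen1 chi1P card1 chi1N1).
exact: (dft_cyc_num a' b' e_gt1 prim_z gen2 chi2P card2 chi2N1).
Qed.

(** If [p = 2] then [e] and [f1] are odd; otherwise [e f1] is even. The same holds for [q] and [f2],
    so in the mixed case the [f] of the odd prime is even. *)
Lemma dcomp_sign_parity (e f1 f2 p r q s : nat)
    (w1 := if p == 2%N then 0%N else f1) (w2 := if q == 2%N then 0%N else f2)
    (v := if (p == 2%N) == (q == 2%N) then (f1 + f2)%N else 0%N)
    (lambda := if (p == 2%N) || (q == 2%N) then 0%N
               else (f1 * f2 * e + f1 + f2)%N) :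
  prime p -> (0 < r)%N -> prime q -> (0 < s)%N ->
  (p ^ r = e * f1 + 1)%N -> (q ^ s = e * f2 + 1)%N ->
  (2 %| w1%:Z + w2%:Z - v%:Z)%Z /\ (2 %| lambda%:Z - (w1%:Z + w2%:Z))%Z.
Proof.
move=> p_pr r_gt0 q_pr s_gt0 pr_eq qs_eq.
have := odd_prime_exp p_pr r_gt0; have := odd_prime_exp q_pr s_gt0.
rewrite pr_eq qs_eq !addn1 /= !oddM.
have even_sub (m n : nat) : odd m = odd n -> (2 %| m%:Z - n%:Z)%Z by lia.
move=> odd2 odd1; rewrite -PoszD; split; apply: even_sub; move: odd1 odd2;
  rewrite /v /lambda /w1 /w2; case: (p == 2%N); case: (q == 2%N);
  by rewrite !oddD ?oddM; case: (odd e); case: (odd f1); case: (odd f2).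
Qed.

Theorem theorem1p1 (e : nat) (he : (1 < e)%N) (d : {unit 'Z_e}) :
  (forall (K : fieldType) (L : splittingFieldType K) (z : L),
     [pchar K] =i pred0 ->
     is_cyclotomic_ext e z ->
     'Gal({:L} / 1%AS) \isog units_Zp e ->
     forall (p1 p2 : K) (v1 v2 : int) (E1 E2 : int -> int -> L),
       gen_jacobi_sums e z p1 v1 E1 ->
       gen_jacobi_sums e z p2 v2 E2 ->
       gen_jacobi_sums e z (p1 * p2) (v1 + v2) (dcomp_jac z d E1 E2) /\
       (forall a b : int,
          (-1) ^ ((v1 + v2) * a + 1) *
            dft_mx z (dcomp_mx d (Cyc_mx e z p1 v1 E1) (Cyc_mx e z p2 v2 E2))
              a b
          = dcomp_jac z d E1 E2 a b))
  /\
  (forall (L : splittingFieldType rat) (z : L),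
     is_cyclotomic_ext e z ->
     forall (p r q s f1 f2 : nat),
       prime p -> (0 < r)%N -> prime q -> (0 < s)%N ->
       (p ^ r = e * f1 + 1)%N -> (q ^ s = e * f2 + 1)%N ->
     forall (F1 F2 : finFieldType) (g1 : {unit F1}) (g2 : {unit F2})
            (chi1 : F1 -> L) (chi2 : F2 -> L),
       #|F1| = (p ^ r)%N -> #|F2| = (q ^ s)%N ->
       generator [set: {unit F1}] g1 -> generator [set: {unit F2}] g2 ->
       is_power_char g1 z chi1 -> is_power_char g2 z chi2 ->
     let J1 := jacobi_sum chi1 in
     let J2 := jacobi_sum chi2 in
     let f := ((p ^ r * q ^ s - 1) %/ e)%N in
     (* In characteristic 2 one has chi(-1) = 1 although f1 (or f2) is odd,
        so the sign exponent there is 0; the same applies to v and lambda. *)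
     let w1 := if p == 2%N then 0%N else f1 in
     let w2 := if q == 2%N then 0%N else f2 in
     let v := if (p == 2%N) == (q == 2%N) then (f1 + f2)%N else 0%N in
     let lambda := if (p == 2%N) || (q == 2%N) then 0%N else f in
     [/\ gen_jacobi_sums e z (p ^ r)%:R w1%:Z J1,
         gen_jacobi_sums e z (q ^ s)%:R w2%:Z J2,
         gen_jacobi_sums e z (p ^ r * q ^ s)%:R v%:Z (dcomp_jac z d J1 J2),
         f = (f1 * f2 * e + f1 + f2)%N &
         forall a b : int,
           (-1) ^ (lambda%:Z * a + 1) *
             dft_mx z (dcomp_mx d (cyc_num_mx L e f1 g1)
                                  (cyc_num_mx L e f2 g2)) a b
           = dcomp_jac z d J1 J2 a b]).
Proof.
split=> [K L z charK [prim_z _] _ p1 p2 v1 v2 E1 E2 gjs1 gjs2|].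
  split=> [|a b]; first exact: gen_jacobi_sums_dcomp.
  exact: dft_dcomp_Cyc.
move=> L z [prim_z _] p r q s f1 f2 p_pr r_gt0 q_pr s_gt0 pr_eq qs_eq.
move=> F1 F2 g1 g2 chi1 chi2 card1 card2 gen1 gen2 chi1P chi2P.
move=> J1 J2 f w1 w2 v lambda.
have gjs1 : gen_jacobi_sums e z (p ^ r)%:R w1%:Z J1.
  exact: (gen_jacobi_sums_power_char prim_z gen1 chi1P p_pr r_gt0 pr_eq card1).
have gjs2 : gen_jacobi_sums e z (q ^ s)%:R w2%:Z J2.
  exact: (gen_jacobi_sums_power_char prim_z gen2 chi2P q_pr s_gt0 qs_eq card2).
have fE : f = (f1 * f2 * e + f1 + f2)%N.
  exact: (pred_mul_div (ltnW he) pr_eq qs_eq).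
have [v_parity lambda_parity] :=
  dcomp_sign_parity p_pr r_gt0 q_pr s_gt0 pr_eq qs_eq.
have [chi1N1 _] := power_charN1 prim_z gen1 chi1P p_pr r_gt0 pr_eq card1.
have [chi2N1 _] := power_charN1 prim_z gen2 chi2P q_pr s_gt0 qs_eq card2.
split; [exact: gjs1 | exact: gjs2 | | exact: fE | move=> a b].
  exact: (gen_jacobi_sums_dcomp_natr d he v_parity gjs1 gjs2).
(* [dcomp_sign_parity] gives the parity of [lambda] with [f] expanded. *)
rewrite /lambda fE.
exact: (dft_dcomp_cyc_num d a b he prim_z gen1 gen2 chi1P chi2P
  (etrans card1 pr_eq) (etrans card2 qs_eq) chi1N1 chi2N1 gjs1 lambda_parity).
Qed.
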